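(* Let $G=(V,E)$ be an (unsigned) graph with $n=|V|\ge2$, regarded as the signed graph with $\sigma\equiv+1$, with edge weight $w\equiv1$, vertex measure $\mu\equiv1$ and potential $\kappa\equiv0$. Then $L_2>0$ if and only if $G$ is complete. Moreover, if $G$ is complete, then $L_2=\frac12$ and $L_n=\frac n4$ if $n$ is even, $L_n=\frac{\sqrt{n^2-1}}4$ if $n$ is odd.
   Context: $G=(V,E)$ is a finite undirected graph without self-loops, $V=\{1,\dots,n\}$. For $p\ge1$ and nonzero $f$, $\mathcal R_p(f)=\frac{\sum_{\{i,j\}\in E}|f(i)-f(j)|^p}{\sum_i|f(i)|^p}$; $\mathcal S_p=\{f:\sum_i|f(i)|^p=1\}$; Krasnoselskii genus $\gamma(B)$ of closed symmetric $B\subset\mathbb R^n\setminus\{0\}$: least $k$ with an odd continuous map $B\to\mathbb R^k\setminus\{0\}$; $\mathcal F_k(\mathcal S_p)$ = closed symmetric $B\subset\mathcal S_p$ with $\gamma(B)\ge k$; $\lambda_k^{(p)}=\min_{B\in\mathcal F_k(\mathcal S_p)}\max_{f\in B}\mathcal R_p(f)$. Cut-off adjacency eigenvalues: $L_k:=\lim_{p\to\infty}2^{-p}\lambda_k^{(p)}$ (the limits exist). *)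

(* Defs.v *)
From HB Require Import structures.
From mathcomp Require Import all_boot all_order all_algebra.
From mathcomp Require Import all_classical all_reals all_analysis.
Set Implicit Arguments. Unset Strict Implicit. Unset Printing Implicit Defensive.
Import Order.TTheory GRing.Theory Num.Theory.
Import numFieldNormedType.Exports.
Local Open Scope classical_set_scope.
Local Open Scope ring_scope.

Section Defs.
Variable R : realType.

(* A finite simple graph on V = 'I_n: e is a symmetric irreflexive relation. *)
Definition complete_graph (n : nat) (e : rel 'I_n) : Prop :=
  forall i j : 'I_n, i != j -> e i j.

Definition edge_sum (n : nat) (e : rel 'I_n) (p : R) (f : 'rV[R]_n) : R :=
  \sum_(i < n) \sum_(j < n | (i < j)%N && e i j) `|f ord0 i - f ord0 j| `^ p.

Definition pnorm_p (n : nat) (p : R) (f : 'rV[R]_n) : R :=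
  \sum_(i < n) `|f ord0 i| `^ p.

Definition rayleigh (n : nat) (e : rel 'I_n) (p : R) (f : 'rV[R]_n) : R :=
  edge_sum e p f / pnorm_p p f.

Definition sphere_p (n : nat) (p : R) : set 'rV[R]_n :=
  [set f | pnorm_p p f = 1].

Definition genus_ge (n : nat) (B : set 'rV[R]_n) (k : nat) : Prop :=
  forall j : nat, (j < k)%N ->
    ~ (exists g : 'rV[R]_n -> 'rV[R]_j,
         {within B, continuous g} /\
         (forall x, B x -> g (- x) = - g x) /\
         (forall x, B x -> g x != 0)).

Definition F_family (n : nat) (p : R) (k : nat) : set (set 'rV[R]_n) :=
  [set B | B `<=` @sphere_p n p /\ closed B /\
           (forall x, B x -> B (- x)) /\ genus_ge B k].

(* lambda_k^(p) = min_{B in F_k} max_{f in B} R_p(f)  (written inf / sup). *)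
Definition lambda_p (n : nat) (e : rel 'I_n) (p : R) (k : nat) : R :=
  inf [set sup [set rayleigh e p f | f in B] | B in @F_family n p k].

Definition L_cut (n : nat) (e : rel 'I_n) (k : nat) : R :=
  lim ((fun p : R => 2 `^ (- p) * lambda_p e p k) @ +oo).

End Defs.

(* Main.v *)
(** After division by 2^p, the edge sum of a p-normalised f on the complete graph
    tends to the sum of sqrt(|f i|^p |f j|^p) over the pairs where f changes sign,
    because ((x + y) / 2)^p - sqrt(x^p y^p) is O(1/p) uniformly on [0, 1]^2, while
    pairs of equal sign contribute at most 2^-p. By AM-GM a cut into parts of sizes
    a and b gives at most sqrt(a b) / 2, with equality for a suitable two-valued f.
    A closed symmetric set of genus n in the sphere is the whole sphere, so L_n is
    the maximum over the most balanced cut. For L_2, upper bounds come from the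
    circles spanned by two coordinates i, j, where the factor 2^(p-1) occurs only if
    i and j are adjacent; the lower bound on a complete graph holds because
    max f^+ - max f^- vanishes somewhere on any set of genus 2.

    That spheres and circles have full genus is the Borsuk-Ulam theorem. It is
    proved with mod-2 chains of ordered simplices in the octahedral sphere:
    hemispheres h_m satisfy d h_(m+1) = h_m + A h_m, where A is the antipodal map;
    this identity survives barycentric subdivision, and Ky Fan's alternating
    cochain then counts an odd number of alternating simplices in every
    dimension. *)
Require Import Defs.
From HB Require Import structures.
From mathcomp Require Import all_boot all_order all_algebra.
From mathcomp Require Import all_classical all_reals all_analysis.
From mathcomp Require Import lra ring zify.
Set Implicit Arguments. Unset Strict Implicit. Unset Printing Implicit Defensive.
Import Order.TTheory GRing.Theory Num.Theory.
Import numFieldNormedType.Exports.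

(** * Mod-2 chains and Ky Fan's formula *)

(** Chains are lists of ordered simplices, and [ev c phi] is the value mod 2 of the cochain [phi] on
    [c]. Chain identities are stated dually, as equalities for all [phi], so that repeated simplices
    cancel by themselves. *)
Definition ev (T : Type) (c : seq (seq T)) (phi : seq T -> bool) : bool :=
  \big[addb/false]_(s <- c) phi s.

(** The complex is augmented: the empty simplex is the face of a vertex. *)
Fixpoint bd (T : Type) (s : seq T) : seq (seq T) :=
  if s is x :: s' then s' :: map (cons x) (bd s') else [::].

Section Boundary.
Variable T : Type.
Implicit Types (s : seq T) (c : seq (seq T)) (phi psi : seq T -> bool).

Lemma ev_add c phi psi : ev c (fun s => phi s (+) psi s) = ev c phi (+) ev c psi.
Proof. exact: big_split. Qed.

Lemma ev_cons s c phi : ev (s :: c) phi = phi s (+) ev c phi.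
Proof. exact: big_cons. Qed.

Lemma eq_ev c phi psi : phi =1 psi -> ev c phi = ev c psi.
Proof. by move=> h; apply: eq_bigr => s _. Qed.

Lemma ev_map (T' : Type) (f : seq T' -> seq T) (c : seq (seq T')) phi :
  ev (map f c) phi = ev c (phi \o f).
Proof. exact: big_map. Qed.

Lemma ev_flatten (T' : Type) (f : seq T' -> seq (seq T)) (c : seq (seq T')) phi :
  ev (flatten (map f c)) phi = ev c (fun r => ev (f r) phi).
Proof.
elim: c => [|s c ih]; first by rewrite /ev !big_nil.
by rewrite /ev big_cons -[X in _ (+) X]ih /= big_cat.
Qed.

Lemma ev_bd_cons x s phi : ev (bd (x :: s)) phi = phi s (+) ev (bd s) (phi \o cons x).
Proof. by rewrite ev_cons ev_map. Qed.

Lemma bd_map (T' : Type) (f : T -> T') s : bd (map f s) = map (map f) (bd s).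
Proof. by elim: s => //= x s ->; rewrite -!map_comp. Qed.

(** Dual form of d d = 0. In a cone [x :: s] the faces of [s] arise twice, from the base and from
    the cones over the faces of [s]. *)
Lemma ev_bd_bd s phi : ev (bd s) (fun r => ev (bd r) phi) = false.
Proof.
elim: s phi => [|x s ih] phi; first by rewrite /ev big_nil.
rewrite ev_bd_cons.
have -> : ev (bd s) ((fun r => ev (bd r) phi) \o cons x) =
    ev (bd s) (fun r => phi r (+) ev (bd r) (phi \o cons x)).
  by apply: eq_ev => r; exact: ev_bd_cons.
by rewrite ev_add ih addbF addbb.
Qed.

End Boundary.

Lemma eq_in_ev (T : eqType) (c : seq (seq T)) phi psi :
  {in c, phi =1 psi} -> ev c phi = ev c psi.
Proof. by move=> h; apply: eq_big_seq. Qed.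

Lemma ev_true (T : eqType) (c : seq (seq T)) phi :
  ev c phi -> exists2 s, s \in c & phi s.
Proof.
move=> h; have [/hasP//|/hasPn nphi] := boolP (has phi c).
by move: h; rewrite /ev big1_seq // => s /andP[_ /nphi /negbTE].
Qed.

Lemma bd_subset (T : eqType) (s r : seq T) : r \in bd s -> {subset r <= s}.
Proof.
elim: s r => //= x s ih r; rewrite inE => /orP[/eqP->|/mapP[q qs ->]] y.
  by rewrite inE orbC => ->.
by rewrite !inE => /orP[->//|/(ih _ qs)->]; rewrite orbT.
Qed.

Lemma size_bd (T : eqType) (s r : seq T) : r \in bd s -> (size r).+1 = size s.
Proof.
by elim: s r => //= x s ih r; rewrite inE => /orP[/eqP->//|/mapP[q /ih <- ->]].
Qed.

(* Summing a symmetric functional over the faces of [s]: the multiset of faces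
   is that of the [rem x s], which only depends on [s] up to permutation. *)
Lemma ev_bd_rem (T : eqType) (s : seq T) phi :
  (forall s1 s2, perm_eq s1 s2 -> phi s1 = phi s2) ->
  ev (bd s) phi = \big[addb/false]_(x <- s) phi (rem x s).
Proof.
elim: s phi => [|x s ih] phi hphi; first by rewrite /ev !big_nil.
rewrite ev_bd_cons big_cons /= eqxx; congr (_ (+) _).
rewrite ih => [|s1 s2 p12]; last by apply: hphi; rewrite perm_cons.
apply: eq_big_seq => y ys /=; case: (eqVneq x y) => [->|//].
by apply: hphi; rewrite perm_sym perm_to_rem.
Qed.

Lemma ev_bd_perm (T : eqType) (s1 s2 : seq T) phi :
  (forall s1 s2, perm_eq s1 s2 -> phi s1 = phi s2) ->
  perm_eq s1 s2 -> ev (bd s1) phi = ev (bd s2) phi.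
Proof.
move=> hphi p12; rewrite !ev_bd_rem// (perm_big _ p12) /=.
apply: eq_big_seq => x xs; apply: hphi; rewrite -(perm_cons x).
rewrite -(permPl (perm_to_rem _)) ?(perm_mem p12) //.
by rewrite -(permPr (perm_to_rem xs)).
Qed.

Fixpoint alternates (b : bool) (s : seq bool) : bool :=
  if s is x :: s' then (x == b) && alternates (~~ b) s' else true.

(** An alternating word stays alternating only if an end is deleted, and exactly one of the two ends
    leaves [b] as first sign. A word that alternates only after a deletion has one pair of equal
    neighbours; either of them may go, so it counts twice. *)
Lemma ev_bd_alternates b s :
  ev (bd s) (alternates b) = alternates b s (+) alternates (~~ b) s.
Proof.
elim: s b => [|x s ih] b; first by rewrite /ev big_nil.
rewrite ev_bd_cons /=.
have -> : ev (bd s) (alternates b \o cons x) =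
    (x == b) && (alternates (~~ b) s (+) alternates b s).
  case: (x =P b) => [->|/eqP/negbTE xb].
    rewrite -[X in _ (+) alternates X _]negbK -ih.
    by apply: eq_ev => r /=; rewrite eqxx.
  by rewrite /ev big1_seq // => r _ /=; rewrite xb.
by case: x b => [] [] /=; case: (alternates true s); case: (alternates false s).
Qed.

Lemma alternates_negb b s : alternates b (map negb s) = alternates (~~ b) s.
Proof. by elim: s b => //= x s ih b; rewrite ih; case: x b => [] []. Qed.

(* The label [2 * j + 1] (resp. [2 * j]) encodes [+ j] (resp. [- j]). *)
Definition flip (a : nat) : nat := if odd a then a.-1 else a.+1.

Lemma odd_flip a : odd (flip a) = ~~ odd a.
Proof. by rewrite /flip; case: ifP; lia. Qed.

Lemma half_flip a : (flip a)./2 = a./2.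
Proof. by rewrite /flip; case: ifP; lia. Qed.

Definition uncomplementary (l : seq nat) : Prop :=
  {in l &, forall a b, a <> flip b}.

(** Ky Fan's cochain: [leq] orders the labels by absolute value, and in that order the signs must
    alternate, starting from [b]. *)
Definition fan (b : bool) (l : seq nat) : bool := alternates b (map odd (sort leq l)).

Lemma fan_perm b l1 l2 : perm_eq l1 l2 -> fan b l1 = fan b l2.
Proof.
by move=> /(perm_sortP leq_total leq_trans anti_leq) h; rewrite /fan h.
Qed.

Lemma sorted_bd l r : sorted leq l -> r \in bd l -> sorted leq r.
Proof.
move=> sl rl; apply: (subseq_sorted leq_trans _ sl).
elim: l r rl {sl} => //= x l ih r; rewrite inE => /orP[/eqP->|/mapP[q /ih qs ->]].
  exact: subseq_cons.
by rewrite /= eqxx.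
Qed.

(** The cochain depends only on the multiset of labels, so these may be sorted, and the faces of a
    sorted list are sorted. *)
Lemma ev_bd_fan b l : ev (bd l) (fan b) = fan b l (+) fan (~~ b) l.
Proof.
have pl : perm_eq l (sort leq l) by rewrite perm_sym perm_sort.
rewrite (ev_bd_perm _ pl); last by move=> *; exact: fan_perm.
rewrite /fan -ev_bd_alternates bd_map ev_map; apply: eq_in_ev => r rl /=.
congr (alternates _ (map _ _)); apply: sorted_sort; first exact: leq_trans.
by apply: sorted_bd rl; exact: (sort_sorted leq_total).
Qed.

(** [flip] reverses the order only within a pair of opposite labels; without such pairs it commutes
    with sorting. *)
Lemma fan_flip b l : uncomplementary l -> fan b (map flip l) = fan (~~ b) l.
Proof.
move=> unc; rewrite /fan -alternates_negb -map_comp.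
have -> : sort leq (map flip l) = map flip (sort leq l).
  apply: (sorted_eq leq_trans anti_leq); first exact: (sort_sorted leq_total).
  - apply: (@homo_sorted_in _ _ (mem l) flip leq leq); last first.
      exact: (sort_sorted leq_total).
      by apply/allP => x; rewrite mem_sort.
    move=> x y xl yl; have := unc _ _ xl yl; have := unc _ _ yl xl.
    by rewrite /flip; case: ifP; case: ifP; lia.
  - by rewrite perm_sort perm_map // perm_sym perm_sort.
rewrite -map_comp; congr alternates; apply: eq_map => x /=.
exact: odd_flip.
Qed.

(** Neighbours in the sorted list differ in sign without being opposite labels, so the absolute
    values increase strictly. *)
Lemma fan_size_le b l d : uncomplementary l -> fan b l ->
  {in l, forall a, (a./2 < d)%N} -> (size l <= d)%N.
Proof.
move=> unc; rewrite /fan -(size_sort leq l).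
have : {subset sort leq l <= l} by move=> x; rewrite mem_sort.
have := sort_sorted leq_total l; move: (sort leq l) => s.
move=> ss sl alt dl.
have : sorted ltn (map half s).
  elim: s b ss sl alt => //= x [//|y s] ih b /= /andP[xy ys] sl /and3P[xb yb alt].
  apply/andP; split.
    have := unc x y (sl x _) (sl y _); rewrite !inE !eqxx ?orbT => /(_ isT isT).
    by move: xb yb; rewrite /flip => /eqP <-; case: ifP; lia.
  apply: (ih (~~ b)) => //=; last by rewrite yb.
  by move=> z zs; apply: sl; rewrite inE zs orbT.
move=> /(sorted_uniq ltn_trans ltnn) us.
rewrite -(size_map half) -(size_iota 0 d); apply: uniq_leq_size => // a.
by move=> /mapP[z /sl /dl zd ->]; rewrite mem_iota.
Qed.

(** * Antipodal chains and their subdivisions *)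

Section AntipodalChains.
Variables (T : eqType) (A : T -> T) (v : nat -> T) (b : seq T -> T).
Hypothesis AK : involutive A.
Hypothesis bA : forall s, b (map A s) = A (b s).
Implicit Types (s : seq T) (phi : seq T -> bool).

(* Modulo 2, [hemi m.+1] is the cone with apex [v m.+1] over the sphere
   [hemi m + A (hemi m)]. *)
Fixpoint hemi (m : nat) : seq (seq T) :=
  if m is m'.+1 then
    flatten [seq [:: v m :: s; v m :: map A s] | s <- hemi m']
  else [:: [:: v 0]].

(* Barycentric subdivision of [s], [b] being the barycentre; [m] is the recursion
   fuel and must be [size s]. *)
Fixpoint sd (m : nat) (s : seq T) : seq (seq T) :=
  if m is m'.+1 then
    flatten [seq map (cons (b s)) (sd m' r) | r <- bd s]
  else [:: s].

Fixpoint sd_hemi (N m : nat) : seq (seq T) :=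
  if N is N'.+1 then flatten (map (sd m.+1) (sd_hemi N' m)) else hemi m.

Lemma sd_hemiS N m : sd_hemi N.+1 m = flatten (map (sd m.+1) (sd_hemi N m)).
Proof. by []. Qed.

Lemma size_hemi m s : s \in hemi m -> size s = m.+1.
Proof.
elim: m s => [|m ih] s /=; first by rewrite inE => /eqP->.
move=> /flatten_mapP[r /ih rm].
by rewrite !inE => /orP[]/eqP->; rewrite /= ?size_map rm.
Qed.

Lemma size_sd m s r : size s = m -> r \in sd m s -> size r = m.
Proof.
elim: m s r => [|m ih] s r /= sm; first by rewrite inE => /eqP->.
move=> /flatten_mapP[q /size_bd qs /mapP[t tq ->]] /=.
by rewrite (ih q) //; apply: succn_inj; rewrite qs.
Qed.

Lemma size_sd_hemi N m s : s \in sd_hemi N m -> size s = m.+1.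
Proof.
elim: N s => [|N ih] s; first exact: size_hemi.
by move=> /flatten_mapP[r /ih rm]; exact: size_sd.
Qed.

Lemma sd_A m s : sd m (map A s) = map (map A) (sd m s).
Proof.
elim: m s => //= m ih s; rewrite bd_map map_flatten -!map_comp bA.
by congr flatten; apply: eq_map => r /=; rewrite ih -!map_comp.
Qed.

Lemma sdS m s :
  sd m.+1 s = flatten [seq map (cons (b s)) (sd m r) | r <- bd s].
Proof. by []. Qed.

(** Subdivision is a chain map: it cones the subdivided boundary, so its boundary is that base plus
    the cone over the boundary of the base, which vanishes by induction and d d = 0. *)
Lemma ev_sd_bd m s phi : size s = m.+1 ->
  ev (sd m.+1 s) (fun r => ev (bd r) phi) = ev (bd s) (fun r => ev (sd m r) phi).
Proof.
elim: m s phi => [|m ih] s phi sm.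
  by case: s sm => [//|x [|//]] _; rewrite /= /ev /= !big_cons !big_nil.
rewrite sdS ev_flatten.
transitivity (ev (bd s) (fun r => ev (sd m.+1 r) phi (+)
    ev (bd r) (fun q => ev (sd m q) (phi \o cons (b s))))); last first.
  by rewrite ev_add ev_bd_bd addbF.
apply: eq_in_ev => r rs; rewrite ev_map.
rewrite -ih; last by apply: succn_inj; rewrite (size_bd rs).
by rewrite -ev_add; apply: eq_ev => q; exact: ev_bd_cons.
Qed.

(** A cone over a cycle has that cycle as boundary, and h_m + A h_m is a cycle because d h_m is
    invariant under A. *)
Lemma ev_hemi_bd m phi : ev (hemi m.+1) (fun s => ev (bd s) phi) =
  ev (hemi m) (fun s => phi s (+) phi (map A s)).
Proof.
have mAK : cancel (map A) (map A) by exact: mapK.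
have cone k psi : ev (hemi k.+1) psi = ev (hemi k)
    (fun s => psi (v k.+1 :: s) (+) psi (v k.+1 :: map A s)).
  rewrite [hemi _]/= ev_flatten; apply: eq_ev => s.
  by rewrite !ev_cons /ev big_nil addbF.
elim: m phi => [|m ih] phi.
  by rewrite /= /ev /= !big_cons !big_nil /=; do 3!case: (phi _).
rewrite cone; set psi := phi \o cons (v m.+2).
transitivity (ev (hemi m.+1) (fun s => phi s (+) phi (map A s)) (+)
  ev (hemi m.+1) (fun s => ev (bd s) (fun r => psi r (+) psi (map A r)))).
  rewrite -ev_add; apply: eq_ev => s; rewrite !ev_bd_cons -/psi ev_add.
  by rewrite bd_map ev_map addbACA.
rewrite ih [X in _ (+) X](_ : _ = false) ?addbF //.
by apply: big1_seq => s _; rewrite mAK [X in _ (+) X]addbC addbb.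
Qed.

Lemma ev_sd_hemi_bd N m phi : ev (sd_hemi N m.+1) (fun s => ev (bd s) phi) =
  ev (sd_hemi N m) (fun s => phi s (+) phi (map A s)).
Proof.
elim: N phi => [|N ih] phi; first exact: ev_hemi_bd.
rewrite sd_hemiS ev_flatten sd_hemiS ev_flatten.
transitivity (ev (sd_hemi N m.+1) (fun s => ev (bd s) (fun r => ev (sd m.+1 r) phi))).
  by apply: eq_in_ev => s /size_sd_hemi; exact: ev_sd_bd.
rewrite ih; apply: eq_ev => s.
by rewrite sd_A ev_map ev_add.
Qed.

Lemma ev_sd_hemi0 N phi : ev (sd_hemi N 0) (fun s => ev (bd s) phi) = phi [::].
Proof.
elim: N phi => [|N ih] phi.
  by rewrite /= /ev big_cons big_nil big_cons big_nil !addbF.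
rewrite sd_hemiS ev_flatten -[RHS]ih.
apply: eq_in_ev => s ss; rewrite ev_sd_bd ?(size_sd_hemi ss) //.
by apply: eq_ev => r; rewrite /= /ev big_cons big_nil addbF.
Qed.

(** By [ev_bd_fan], the number of simplices of h_m + A h_m that alternate from the positive sign has
    the parity of the cochain on d h_m, which is the same number for m - 1. The induction starts at
    the empty simplex, where the cochain is 1. *)
Lemma exists_fan N d (lab : T -> nat) :
  (forall m s, (m <= d)%N -> s \in sd_hemi N m ->
    {in s, forall x, lab (A x) = flip (lab x)} /\ uncomplementary (map lab s)) ->
  exists2 s, s \in sd_hemi N d & exists b', fan b' (map lab s).
Proof.
move=> good; pose F s := fan true (map lab s).
have FA m s : (m <= d)%N -> s \in sd_hemi N m -> F s (+) F (map A s) = ev (bd s) F.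
  move=> md /(good _ _ md)[labA unc]; rewrite /F -map_comp.
  have -> : map (lab \o A) s = map flip (map lab s).
    by rewrite -map_comp; apply/eq_in_map => x xs /=; exact: labA.
  by rewrite fan_flip // -ev_bd_fan bd_map ev_map; apply: eq_ev.
have odd_count m : (m <= d)%N -> ev (sd_hemi N m) (fun s => F s (+) F (map A s)).
  elim: m => [|m ih] md.
    by rewrite (eq_in_ev (FA 0 ^~ md)) ev_sd_hemi0.
  by rewrite (eq_in_ev (FA m.+1 ^~ md)) ev_sd_hemi_bd ih // ltnW.
have [s sd Fs] := ev_true (odd_count d (leqnn _)).
exists s => //; have [labA unc] := good _ _ (leqnn _) sd.
move: Fs; have [Fs _|_] := boolP (F s); first by exists true.
(* Here [A s] is the alternating simplex; its labels are flipped, so [s] alternates from the other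
   sign. *)
rewrite addFb /F -map_comp => Fs; exists false.
rewrite -[false]/(~~ true) -fan_flip // -map_comp.
by rewrite -(_ : map (lab \o A) s = map (flip \o lab) s) //; apply/eq_in_map.
Qed.

End AntipodalChains.

Local Open Scope classical_set_scope.
Local Open Scope ring_scope.

(** * The Borsuk-Ulam theorem *)

Lemma ler_coord_norm (R : realType) n (x : 'rV[R]_n) i : `|x ord0 i| <= `|x|.
Proof. by rewrite [leRHS]/Num.norm/= mx_normrE; exact: (le_bigmax _ _ (ord0, i)). Qed.

Lemma sumr_const_seq (V : zmodType) (T : Type) (s : seq T) (c : V) :
  \sum_(x <- s) c = c *+ size s.
Proof. by rewrite big_const_seq count_predT iter_addr_0. Qed.

(** * Barycentric subdivision in a normed space *)

Section Barycentre.
Variables (R : realType) (V : normedModType R).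
Implicit Types (s r : seq V) (C : V -> Prop).

Definition bary s : V := (size s)%:R^-1 *: \sum_(x <- s) x.

Lemma baryN s : bary (map -%R s) = - bary s.
Proof. by rewrite /bary size_map big_map sumrN scalerN. Qed.

(** Convexity, in terms of the averages that subdivision forms. *)
Definition avg_closed C : Prop :=
  forall s, s <> [::] -> {in s, forall x, C x} -> C (bary s).

Lemma bary_sub s z : (0 < size s)%N ->
  bary s - z = (size s)%:R^-1 *: \sum_(x <- s) (x - z).
Proof.
move=> ps; rewrite big_split /= sumr_const_seq scalerDr mulNrn scalerN.
by rewrite -[z *+ _]scaler_nat scalerA mulVf ?scale1r // pnatr_eq0 -lt0n.
Qed.

Lemma avg_closed_ball c e : avg_closed (fun x => `|c - x| <= e).
Proof.
move=> s s0 sC; have ps : (0 < size s)%N by case: s s0 {sC}.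
rewrite distrC bary_sub // normrZ ger0_norm ?invr_ge0 // -ler_pdivlMl ?invr_gt0 ?ltr0n // invrK.
apply: (le_trans (ler_norm_sum _ _ _)).
rewrite mulr_natl -sumr_const_seq !big_seq; apply: ler_sum => x xs.
by rewrite distrC; exact: sC.
Qed.

Lemma sd_avg_closed C m s r : avg_closed C -> size s = m ->
  {in s, forall x, C x} -> r \in sd bary m s -> {in r, forall x, C x}.
Proof.
move=> avgC; elim: m s r => [|m ih] s r /= sm sC; first by rewrite inE => /eqP->.
move=> /flatten_mapP[q qs /mapP[t tq ->]] x; rewrite inE => /orP[/eqP->|xt].
  by apply: avgC sC => s0; rewrite s0 in sm.
apply: ih tq _ xt; first by apply: succn_inj; rewrite (size_bd qs).
by move=> y /(bd_subset qs)/sC.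
Qed.

(** In the average of the differences [x - z], the term of [z] itself vanishes. *)
Lemma bary_dist s D z : {in s &, forall x y, `|x - y| <= D} -> z \in s ->
  `|bary s - z| <= (1 - (size s)%:R^-1) * D.
Proof.
move=> sD zs; have ps : (0 < size s)%N by case: s zs {sD}.
have ps' : 0 < (size s)%:R :> R by rewrite ltr0n.
rewrite bary_sub // normrZ ger0_norm ?invr_ge0 // -ler_pdivlMl ?invr_gt0 // invrK.
apply: (le_trans (ler_norm_sum _ _ _)).
rewrite (big_rem z) //= subrr normr0 add0r.
have -> : (size s)%:R * ((1 - (size s)%:R^-1) * D) = (size (rem z s))%:R * D.
  by rewrite size_rem // -subn1 natrB // mulrA mulrBr mulr1 divff ?gt_eqF.
rewrite mulr_natl -sumr_const_seq !big_seq; apply: ler_sum => x xs.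
by apply: sD => //; exact: mem_rem xs.
Qed.

(** Balls are closed under averages, so new vertices are as close to the barycentre as old ones;
    pairs without the barycentre lie in a subdivided face. Bounding sizes by n + 1 gives one factor
    for all faces. *)
Lemma sd_diam n m s r D : (m <= n.+1)%N -> size s = m -> 0 <= D ->
  {in s &, forall x y, `|x - y| <= D} -> r \in sd bary m s ->
  {in r &, forall x y, `|x - y| <= (1 - n.+1%:R^-1) * D}.
Proof.
move=> mn + D0; elim: m mn s r => [|m ih] mn s r /= sm sD.
  by rewrite inE => /eqP-> x y; case: s sm {sD}.
have k0 : 0 <= 1 - n.+1%:R^-1 :> R by rewrite subr_ge0 invf_le1 ?ler1n ?ltr0n.
move=> /flatten_mapP[q qs /mapP[t tq ->]].
have bt x : x \in t -> `|bary s - x| <= (1 - n.+1%:R^-1) * D.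
  apply: (sd_avg_closed (@avg_closed_ball _ _) _ _ tq).
    by apply: succn_inj; rewrite (size_bd qs).
  move=> y /(bd_subset qs) ys; apply: (le_trans (bary_dist sD ys)).
  rewrite ler_wpM2r // lerD2l lerN2 lef_pV2 ?posrE ?ltr0n ?sm // ler_nat //.
move=> x y; rewrite !inE => /orP[/eqP->|xt] /orP[/eqP->|yt].
- by rewrite subrr normr0 mulr_ge0.
- exact: bt.
- by rewrite distrC; exact: bt.
- apply: ih tq _ _ xt yt => //; first exact: ltnW.
    by apply: succn_inj; rewrite (size_bd qs).
  by move=> a c /(bd_subset qs) ha /(bd_subset qs) hc; exact: sD.
Qed.

End Barycentre.

(** * The octahedral sphere *)

Section Octahedron.
Variables (R : realType) (n : nat).
Notation V := 'rV[R]_n.+1.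

Definition vtx (k : nat) : V := delta_mx ord0 (inord k).

(** The linear form equal to 1 on the facet of the octahedron with signs [eps]; it keeps subdivided
    simplices away from the origin. *)
Definition octant (eps : 'I_n.+1 -> bool) (x : V) : R :=
  \sum_i (-1) ^+ eps i * x ord0 i.

Definition oct_vertex (eps : 'I_n.+1 -> bool) i : V := (-1) ^+ eps i *: delta_mx ord0 i.

Lemma norm_oct_vertex eps i : `|oct_vertex eps i| = 1.
Proof.
rewrite /oct_vertex normrZ normrX normrN1 expr1n mul1r.
apply/eqP; rewrite eq_le; apply/andP; split.
  rewrite /Num.norm/= mx_normrE; apply/bigmax_leP; split => // -[a c] _ /=.
  by rewrite mxE; case: andP => _; rewrite ?normr1 ?normr0.
apply: le_trans (ler_coord_norm _ i).
by rewrite mxE !eqxx normr1.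
Qed.

Lemma octant_vertex eps i : octant eps (oct_vertex eps i) = 1.
Proof.
rewrite /octant /oct_vertex (bigD1 i) //= big1 => [|j ji].
  by rewrite !mxE !eqxx mulr1 addr0 -expr2 sqrr_sign.
by rewrite !mxE eqxx (negbTE ji) !mulr0.
Qed.

Lemma octant_avg_closed eps : avg_closed (fun x => octant eps x = 1).
Proof.
move=> s s0 sC; have ps : (0 < size s)%N by case: s s0 {sC}.
have octZ a x : octant eps (a *: x) = a * octant eps x.
  rewrite /octant mulr_sumr; apply: eq_bigr => i _.
  by rewrite mxE mulrCA.
have octD r : octant eps (\sum_(x <- r) x) = \sum_(x <- r) octant eps x.
  rewrite exchange_big; apply: eq_bigr => i _ /=.
  by rewrite summxE mulr_sumr.
rewrite octZ octD big_seq (eq_bigr (fun=> 1)) => [|x /sC//].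
rewrite -big_seq sumr_const_seq mulVf //.
by rewrite pnatr_eq0 -lt0n.
Qed.

(** Each cone uses a new axis, so one choice of signs serves a whole simplex; the antipode of the
    base only reverses the signs on the older axes. *)
Lemma mem_hemi m s : (m <= n)%N -> s \in hemi -%R vtx m ->
  exists eps, {in s, forall x, exists2 i : 'I_n.+1, (i <= m)%N & x = oct_vertex eps i}.
Proof.
have vE k eps : eps (inord k) = false -> vtx k = oct_vertex eps (inord k).
  by move=> h; rewrite /oct_vertex h scale1r.
elim: m s => [|m ih] s mn /=.
  rewrite inE => /eqP->; exists (fun=> false) => x; rewrite inE => /eqP->.
  by exists (inord 0); [rewrite inordK|exact: vE].
move=> /flatten_mapP[r /ih-/(_ (ltnW mn))[eps hr]].
have neq (i : 'I_n.+1) : (i <= m)%N -> (i == inord m.+1) = false.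
  move=> im; apply/negP => /eqP ie; move: im.
  by rewrite ie inordK // ltnn.
rewrite !inE => /orP[]/eqP->.
- exists (fun i => if i == inord m.+1 then false else eps i) => x.
  rewrite inE => /orP[/eqP->|/hr[i im ->]].
    by exists (inord m.+1); [rewrite inordK|apply: vE; rewrite eqxx].
  by exists i; [exact: leqW|rewrite /oct_vertex neq].
- exists (fun i => if i == inord m.+1 then false else ~~ eps i) => x.
  rewrite inE => /orP[/eqP->|/mapP[y /hr[i im ->] ->]].
    by exists (inord m.+1); [rewrite inordK|apply: vE; rewrite eqxx].
  exists i; first exact: leqW.
  by rewrite /oct_vertex neq // -scaleNr; case: (eps i); rewrite /= ?opprK.
Qed.

Lemma mem_sd_hemi N m s : (m <= n)%N -> s \in sd_hemi -%R vtx (@bary R V) N m ->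
  [/\ exists eps, {in s, forall x, octant eps x = 1},
      {in s, forall x, `|x| <= 1} &
      {in s &, forall x y, `|x - y| <= (1 - n.+1%:R^-1) ^+ N * 2}].
Proof.
move=> mn; elim: N s => [|N ih] s.
  move=> /(mem_hemi mn)[eps hs].
  have s1 x : x \in s -> `|x| <= 1 by move=> /hs[i _ ->]; rewrite norm_oct_vertex.
  split => //; first by exists eps => x /hs[i _ ->]; exact: octant_vertex.
  move=> x y /s1 x1 /s1 y1; rewrite mul1r (le_trans (ler_normB _ _)) //.
  by rewrite -[2]/(1 + 1) lerD.
rewrite sd_hemiS => /flatten_mapP[r rm sr].
have [[eps hr] r1 rD] := ih _ rm; have size_r := size_sd_hemi rm.
split.
- exists eps; apply: sd_avg_closed hr sr => //; exact: octant_avg_closed.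
- move=> x xs; rewrite -normrN -[- x]add0r; move: x xs.
  apply: (sd_avg_closed (@avg_closed_ball _ _ _ _) size_r _ sr).
  by move=> x /r1; rewrite add0r normrN.
- move=> x y xs ys; rewrite exprS -mulrA.
  apply: (sd_diam _ size_r _ rD sr) => //.
  rewrite mulr_ge0 // exprn_ge0 // subr_ge0 invf_le1 ?ler1n ?ltr0n //.
Qed.

Lemma octant_norm eps x : octant eps x = 1 -> n.+1%:R^-1 <= `|x|.
Proof.
move=> ox; rewrite -[_^-1]mul1r ler_pdivrMr ?ltr0n // -[X in X <= _]ox.
apply: (@le_trans _ _ (\sum_(i < n.+1) `|x|)).
  apply: ler_sum => i _; apply: (le_trans (ler_norm _)).
  by rewrite normrM normrX normrN1 expr1n mul1r ler_coord_norm.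
by rewrite sumr_const card_ord mulr_natr.
Qed.

End Octahedron.

(** Heine-Cantor on [K]: half a radius of continuity at [x] serves all points near [x], and
    compactness makes the choice uniform. *)
Lemma compact_uniform (R : realType) (V W : normedModType R) (K : set V) (h : V -> W) :
  compact K -> {within K, continuous h} ->
  forall d, 0 < d -> exists2 e, 0 < e &
    forall x y, K x -> K y -> `|x - y| < e -> `|h x - h y| < d.
Proof.
move=> /compact_near_coveringP cK /subspace_continuousP ch d d0.
pose P (e : R) (x : V) := K x -> forall y, K y -> `|x - y| < e -> `|h x - h y| < d.
have : \forall e \near 0^'+, K `<=` P e.
  apply: cK => x Kx.
  have d20 : 0 < d / 2 by rewrite divr_gt0.
  have /cvgrPdist_lt/(_ _ d20)/nbhs_ballP[r /= r0 hr] := ch x Kx.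
  have hr' z : K z -> `|x - z| < r -> `|h x - h z| < d / 2.
    by move=> Kz xz; apply: hr => //; rewrite -ball_normE.
  have r20 : 0 < r / 2 by rewrite divr_gt0.
  exists (ball x (r / 2), [set e | e < r / 2]) => /=.
    split; first exact: nbhsx_ballx.
    exact: nbhs_right_lt.
  move=> [x' e] /= []; rewrite -ball_normE /= => xx' er Kx' y Ky x'y.
  have h1 : `|h x - h x'| < d / 2.
    by apply: hr' => //; apply: (lt_le_trans xx'); lra.
  have h2 : `|h x - h y| < d / 2.
    by apply: hr' => //; apply: (le_lt_trans (ler_distD x' _ _)); lra.
  apply: (le_lt_trans (ler_distD (h x) _ _)); rewrite [`|h x' - _|]distrC; lra.
move=> [e /= e0 he]; exists (e / 2); first by rewrite divr_gt0.
move=> x y Kx Ky xy; apply: (he (e / 2)) => //; last by rewrite divr_gt0.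
by rewrite /ball_/= sub0r normrN gtr0_norm ?divr_gt0 //; lra.
Qed.

Section BorsukUlam.
Variable R : realType.

(** A compact symmetric set off the origin that contains all vertices of the subdivided octahedron,
    by [octant_norm]. *)
Definition shell n : set 'rV[R]_n.+1 := [set x | n.+1%:R^-1 <= `|x| <= 1].
Arguments shell : clear implicits.

Lemma shell_compact n : compact (shell n).
Proof.
apply: bounded_closed_compact.
  by exists 1; split => // M M1 x /andP[_ x1]; exact: le_trans x1 (ltW M1).
have -> : shell n = (fun x : 'rV[R]_n.+1 => `|x|) @^-1` [set` `[n.+1%:R^-1, 1]].
  by apply/seteqP; split => x /=; rewrite in_itv.
apply: closed_comp; last exact: itv_closed.
by move=> x _; exact: norm_continuous.
Qed.

Lemma shell_vtx n : shell n (vtx R n 0).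
Proof.
have -> : vtx R n 0 = oct_vertex R (fun=> false) (inord 0).
  by rewrite /oct_vertex scale1r.
by rewrite /shell /= norm_oct_vertex lexx andbT invf_le1 ?ler1n ?ltr0n.
Qed.

Lemma exists_geometric_lt (q e : R) : 0 <= q < 1 -> 0 < e -> exists N, q ^+ N < e.
Proof.
move=> /andP[q0 q1] e0.
have : q ^+ k @[k --> \oo] --> (0 : R) by apply: cvg_expr; rewrite ger0_norm.
move=> /cvgrPdist_lt/(_ _ e0)[N _ /(_ N (leqnn _))] /=.
by rewrite sub0r normrN ger0_norm ?exprn_ge0 // => h; exists N.
Qed.

Section Labelling.
Variables (T : Type) (d : nat) (h : T -> 'rV[R]_d).

(** A coordinate where [h x] attains its sup norm, with its sign, in the encoding of [flip]. The
    default 0 occurs only for d = 0. *)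
Definition label (x : T) : nat :=
  if [pick j | `|h x ord0 j| == `|h x|] is Some j
  then (0 < h x ord0 j)%R + (val j).*2 else 0%N.

Lemma labelP x : h x != 0 -> exists j : 'I_d,
  `|h x ord0 j| = `|h x| /\ label x = ((0 < h x ord0 j)%R + (val j).*2)%N.
Proof.
move=> hx; rewrite /label; case: pickP => [j /eqP hj|no]; first by exists j.
have [[i j] /= hij] : exists i, mx_norm (h x) = `|h x i.1 i.2|.
  by apply: mx_norm_neq0; apply: contra hx => /eqP/mx_norm_eq0 ->.
by have := no j; rewrite -[X in _ == X]/(mx_norm _) hij /= (ord1 i) eqxx.
Qed.

Lemma label_opp x y : h x != 0 -> h y = - h x -> label y = flip (label x).
Proof.
move=> hx hy; have := labelP hx; rewrite /label hy normrN.
(* The predicates for [h x] and [- h x] agree, so [pick] returns the same coordinate. *)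
rewrite (@eq_pick _ _ (fun j => `|h x ord0 j| == `|h x|)); last first.
  by move=> j /=; rewrite mxE normrN.
case: pickP => [k /eqP hk _|no [j [/eqP]]]; last by rewrite no.
have hk0 : h x ord0 k != 0 by rewrite -normr_eq0 hk normr_eq0.
rewrite mxE oppr_gt0 /flip oddD odd_double addbF oddb.
by case: ltgtP hk0.
Qed.

End Labelling.

(** Opposite labels in one simplex would make [h] vary there by at least twice the minimum of its
    norm, against uniform continuity on a fine subdivision. So some simplex has n + 1 alternating
    labels, with distinct absolute values below d. *)
Theorem borsuk_ulam_shell n d (h : 'rV[R]_n.+1 -> 'rV[R]_d) :
  {within shell n, continuous h} ->
  (forall x, shell n x -> h (- x) = - h x) ->
  (forall x, shell n x -> h x != 0) -> (n < d)%N.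
Proof.
move=> ch hN h0.
have [c /set_mem Kc cmin] : exists2 c, c \in shell n &
    forall t, t \in shell n -> `|h c| <= `|h t|.
  apply: (@compact_EVT_min _ _ (fun x => `|h x|)).
  - by exists (vtx R n 0); exact: shell_vtx.
  - exact: shell_compact.
  - by apply: within_continuous_comp ch => x _; exact: norm_continuous.
have hc0 : 0 < `|h c| by rewrite normr_gt0; exact: h0.
have [e e0 he] := compact_uniform (@shell_compact n) ch hc0.
(* Diameters start at most 2, hence [e / 2]. *)
have [|N hN'] := @exists_geometric_lt (1 - n.+1%:R^-1) (e / 2) _ (divr_gt0 e0 (ltr0Sn _ _)).
  by rewrite subr_ge0 invf_le1 ?ler1n ?ltr0n //= ltrBlDr ltrDl invr_gt0 ltr0n.
pose chain m := sd_hemi -%R (vtx R n) (@bary R _) N m.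
have shellP m s : (m <= n)%N -> s \in chain m -> {in s, forall x, shell n x}.
  move=> mn /(mem_sd_hemi mn)[[eps os] s1 _] x xs.
  by rewrite /shell /= s1 // (octant_norm (os _ xs)).
have unc m s : (m <= n)%N -> s \in chain m -> uncomplementary (map (label h) s).
  move=> mn sm _ _ /mapP[x xs ->] /mapP[y ys ->].
  have [Kx Ky] := (shellP _ _ mn sm _ xs, shellP _ _ mn sm _ ys).
  have [_ _ /(_ x y xs ys) dxy] := mem_sd_hemi mn sm.
  have [j [hj ->]] := labelP (h0 _ Kx); have [k [hk ->]] := labelP (h0 _ Ky) => jk.
  have kj : k = j.
    by apply: val_inj; have := congr1 half jk; rewrite half_flip !half_bit_double.
  subst k; have := congr1 odd jk; rewrite odd_flip !oddD !odd_double !addbF !oddb.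
  have : `|h x - h y| < `|h c|.
    apply: he => //; apply: (le_lt_trans dxy).
    by rewrite -ltr_pdivlMr.
  have := ler_coord_norm (h x - h y) j; rewrite !mxE => le1 lt1.
  have cx := cmin x (mem_set Kx); have cy := cmin y (mem_set Ky).
  move: (le_lt_trans le1 lt1); rewrite ltr_norml => /andP[lo hi].
  rewrite -hj in cx; rewrite -hk in cy.
  case: (ltP 0 (h x ord0 j)) cx => xj; case: (ltP 0 (h y ord0 j)) cy => yj //=.
    by rewrite ler0_norm // gtr0_norm // => *; lra.
  by rewrite gtr0_norm // ler0_norm // => *; lra.
have [s sN [b fs]] : exists2 s, s \in chain n & exists b, fan b (map (label h) s).
  apply: (exists_fan (@opprK _) (@baryN _ _)) => m s mn sm.
  split; last exact: unc sm.
  by move=> x xs; have Kx := shellP _ _ mn sm _ xs; apply: label_opp; [exact: h0|exact: hN].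
rewrite -(size_sd_hemi sN) -(size_map (label h)).
apply: (fan_size_le (unc _ _ _ sN) fs) => // _ /mapP[x xs ->].
have [j [_ ->]] := labelP (h0 _ (shellP _ _ (leqnn _) sN _ xs)).
rewrite half_bit_double; exact: ltn_ord.
Qed.

End BorsukUlam.
Arguments shell : clear implicits.

(** * Continuity and the genus of the p-sphere *)

Lemma within_continuous_comp2 (T U V : topologicalType) (A : set T) (B : set U)
    (f : T -> U) (g : U -> V) :
  (forall x, A x -> {for x, continuous f}) -> (forall x, A x -> B (f x)) ->
  {within B, continuous g} -> {within A, continuous (g \o f)}.
Proof.
move=> cf AB /subspace_continuousP cg; apply/subspace_continuousP => x Ax.
move=> W /(cg _ (AB _ Ax)) hW.
have {}hW : nbhs (f x) [set y | B y -> W (g y)] := hW.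
suff : nbhs x [set z | A z -> W (g (f z))] by [].
have cfx : nbhs x (f @^-1` [set y | B y -> W (g y)]) := cf _ Ax _ hW.
by apply: filterS cfx => z /= hz /AB/hz.
Qed.

Lemma sum_continuous (R : realType) (V : normedModType R) (T : topologicalType)
    (I : Type) (r : seq I) (F : I -> T -> V) : (forall i, continuous (F i)) ->
  continuous (fun x => \sum_(i <- r) F i x).
Proof.
move=> cF; apply: (@continuous_big V I +%R 0 xpredT) => [|i _]; last exact: cF.
exact: add_continuous.
Qed.

Lemma mulmxr_continuous (R : realType) m n (M : 'M[R]_(m, n)) :
  continuous (fun x : 'rV[R]_m => x *m M).
Proof.
have -> : (fun x : 'rV[R]_m => x *m M) = (fun x => \sum_i x ord0 i *: row i M).
  by apply/funext => x; rewrite mulmx_sum_row.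
apply: sum_continuous => i x.
by apply: (@cvgZr_tmp _ _ _ (nbhs x)); exact: coord_continuous.
Qed.

Lemma bigmax_continuous (R : realType) (T : topologicalType) (I : Type) (r : seq I)
    (F : I -> T -> R) (c : R) : (forall i, continuous (F i)) ->
  continuous (fun x => \big[Num.max/c]_(i <- r) F i x).
Proof.
move=> cF; apply: (@continuous_big R^o I Num.max c xpredT) => [|i _]; last exact: cF.
exact: max_continuous.
Qed.

Section PNorm.
Variables (R : realType) (p : R).
Hypothesis p1 : 1 <= p.

Let p0 : 0 < p. Proof. exact: lt_le_trans p1. Qed.

(** Away from 0 the function is differentiable; near 0 it is at most [|t|]. *)
Lemma powR_norm_continuous : continuous (fun t : R => `|t| `^ p).
Proof.
move=> t; have [->|t0] := eqVneq t 0.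
  rewrite /continuous_at normr0 powR0 ?gt_eqF //.
  apply/cvgrPdist_lt => e e0.
  have m0 : 0 < Num.min e 1 by rewrite lt_min e0 ltr01.
  near=> x; rewrite sub0r normrN ger0_norm ?powR_ge0 //.
  have : `|0 - x| < Num.min e 1.
    near: x; by apply/nbhs_ballP; exists (Num.min e 1).
  rewrite sub0r normrN lt_min => /andP[xe x1].
  have [->|x0] := eqVneq x 0; first by rewrite normr0 powR0 ?gt_eqF.
  by apply: le_lt_trans xe; rewrite ge1r_powR // normr_gt0 x0 ltW.
apply: (@continuous_comp _ _ _ (fun t : R => `|t|) (fun t => t `^ p)).
  exact: norm_continuous.
apply: differentiable_continuous; apply/derivable1_diffP.
by apply: derivable_powR; rewrite in_itv /= andbT normr_gt0.
Unshelve. all: by end_near. Qed.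

Lemma pnorm_continuous n : continuous (@pnorm_p R n p).
Proof.
apply: (@sum_continuous R R^o) => i x.
apply: (@continuous_comp _ _ _ (fun x : 'rV[R]_n => x ord0 i) (fun t => `|t| `^ p)).
  exact: coord_continuous.
exact: powR_norm_continuous.
Qed.

Lemma pnorm_ge0 n (x : 'rV[R]_n) : 0 <= pnorm_p p x.
Proof. by apply: sumr_ge0 => i _; exact: powR_ge0. Qed.

Lemma pnorm_eq0 n (x : 'rV[R]_n) : (pnorm_p p x == 0) = (x == 0).
Proof.
apply/eqP/eqP => [|->]; last first.
  by rewrite /pnorm_p big1 // => i _; rewrite mxE normr0 powR0 // gt_eqF.
move=> /psumr_eq0P h; apply/rowP => i; rewrite mxE; apply/eqP.
rewrite -normr_eq0; apply/eqP/powR_eq0_eq0/(h _ i) => // *; exact: powR_ge0.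
Qed.

Lemma pnormZ n a (x : 'rV[R]_n) : pnorm_p p (a *: x) = `|a| `^ p * pnorm_p p x.
Proof.
by rewrite /pnorm_p mulr_sumr; apply: eq_bigr => i _; rewrite mxE normrM powRM.
Qed.

Lemma pnormN n (x : 'rV[R]_n) : pnorm_p p (- x) = pnorm_p p x.
Proof. by rewrite -scaleN1r pnormZ normrN1 powR1 mul1r. Qed.

Lemma sphere_closed n : closed (@sphere_p R n p).
Proof.
rewrite (_ : sphere_p p = pnorm_p p @^-1` [set 1]) //.
apply: closed_comp; last exact: closed_eq.
by move=> x _; exact: pnorm_continuous.
Qed.

(** Radial projection; [pnorm_p] is the p-th power of the norm, hence the exponent. *)
Definition pproj n (x : 'rV[R]_n) : 'rV[R]_n := pnorm_p p x `^ (- p^-1) *: x.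

Lemma pproj_sphere n (x : 'rV[R]_n) : x != 0 -> sphere_p p (pproj x).
Proof.
move=> x0; have P0 : 0 < pnorm_p p x by rewrite lt0r pnorm_eq0 x0 pnorm_ge0.
rewrite /sphere_p /= pnormZ ger0_norm ?powR_ge0 // -powRrM mulNr mulVf ?gt_eqF //.
by rewrite powR_inv1 ?ltW // mulVf // gt_eqF.
Qed.

Lemma pprojN n (x : 'rV[R]_n) : pproj (- x) = - pproj x.
Proof. by rewrite /pproj pnormN scalerN. Qed.

Lemma pproj_continuous n (x : 'rV[R]_n) : x != 0 -> {for x, continuous (@pproj n)}.
Proof.
move=> x0; have P0 : 0 < pnorm_p p x by rewrite lt0r pnorm_eq0 x0 pnorm_ge0.
apply: (@cvgZ _ _ _ (nbhs x)); last exact: cvg_id.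
apply: (@continuous_comp _ _ _ (@pnorm_p R n p) (fun t => t `^ (- p^-1))).
  exact: pnorm_continuous.
apply: differentiable_continuous; apply/derivable1_diffP.
by apply: derivable_powR; rewrite in_itv /= andbT.
Qed.

(** Radial projection carries the shell oddly into the sphere, so Borsuk-Ulam applies to the
    composite map. *)
Theorem genus_ge_sphere n : genus_ge (@sphere_p R n p) n.
Proof.
case: n => [//|n] j jn [g [cg [gN g0]]].
have shell0 x : shell R n x -> x != 0.
  by move=> /andP[+ _]; rewrite -normr_gt0; apply: lt_le_trans; rewrite invr_gt0 ltr0n.
suff : (n < j)%N by rewrite ltnNge -ltnS jn.
apply: (@borsuk_ulam_shell R n j (g \o @pproj n.+1)).
- apply: within_continuous_comp2 cg => x /shell0; first exact: pproj_continuous.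
  exact: pproj_sphere.
- by move=> x /shell0 x0; rewrite /= pprojN gN //; exact: pproj_sphere.
- by move=> x /shell0 x0; apply: g0; exact: pproj_sphere.
Qed.

End PNorm.

Lemma genus_ge_odd_map (R : realType) m n k (A : set 'rV[R]_m) (B : set 'rV[R]_n)
    (f : 'rV[R]_m -> 'rV[R]_n) :
  continuous f -> (forall x, f (- x) = - f x) -> (forall x, A x -> B (f x)) ->
  genus_ge A k -> genus_ge B k.
Proof.
move=> cf fN AB gA j jk [g [cg [gN g0]]]; apply: (gA j jk); exists (g \o f).
split; first by apply: within_continuous_comp2 cg => // x _; exact: cf.
by split=> x /AB Bx; [rewrite /= fN gN|exact: g0].
Qed.

(* Otherwise, projecting along a missing point of the sphere maps [B] oddly into a
   space of smaller dimension without reaching the origin. *)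
Lemma genus_ge_full (R : realType) n (p : R) (B : set 'rV[R]_n) : 1 <= p ->
  B `<=` sphere_p p -> (forall x, B x -> B (- x)) -> genus_ge B n ->
  sphere_p p `<=` B.
Proof.
move=> p1 BS BN gB f Sf; apply: contrapT => nBf.
have p0 : p != 0 by rewrite gt_eqF // (lt_le_trans _ p1).
have f0 : f != 0.
  rewrite -(pnorm_eq0 p1); have -> : pnorm_p p f = 1 := Sf.
  exact: oner_neq0.
have rf : \rank f = 1%N by rewrite rank_rV f0.
have rC : (\rank (cokermx f) < n)%N.
  rewrite mxrank_coker rf; case: n {B BS BN gB Sf nBf rf} f f0 => [f|n f _].
    by rewrite thinmx0 eqxx.
  by rewrite subn1.
(* The kernel of this map is the line of [f], which meets the sphere only in [f] and [- f]; the
   target has dimension n - 1. *)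
apply: (gB _ rC); exists (fun x => x *m col_base (cokermx f)); split.
  by apply: continuous_subspaceT; exact: mulmxr_continuous.
split=> x Bx; first by rewrite mulNmx.
apply/eqP => xC0; have : (x <= f)%MS.
  by rewrite submxE -(mulmx_base (cokermx f)) mulmxA xC0 mul0mx.
move=> /sub_rVP[a xa]; have : pnorm_p p x = 1 := BS _ Bx.
have Sf1 : pnorm_p p f = 1 := Sf.
rewrite xa pnormZ Sf1 mulr1 => /eqP.
rewrite powR_eq1 (negbTE p0) orbF [_ < 0]ltNge normr_ge0 orbF.
rewrite eqr_norml ler01 andbT => /orP[]/eqP a1; apply: nBf.
  by rewrite a1 scale1r in xa; rewrite -xa.
by rewrite a1 scaleN1r in xa; rewrite -[f]opprK -xa; exact: BN.
Qed.

(** * Real powers *)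

Section PowerInequalities.
Variable R : realType.
Implicit Types (p x y r u : R).

(** Young's inequality for [r] and 1 with exponents p and its conjugate. *)
Lemma powR_bernoulli p r : 1 < p -> 0 <= r -> 1 + p * (r - 1) <= r `^ p.
Proof.
move=> p1 r0; have p0 : 0 < p by apply: lt_trans p1.
have q0 : 0 < (1 - p^-1)^-1 by rewrite invr_gt0 subr_gt0 invf_lt1.
have := @conjugate_powR R r 1 p (1 - p^-1)^-1 r0 ler01 p0 q0.
rewrite invrK [p^-1 + _]addrC subrK powR1 mulr1 mul1r => /(_ erefl).
have -> : r `^ p / p + (1 - p^-1) = (r `^ p + p - 1) / p by field; rewrite gt_eqF.
rewrite ler_pdivlMr // => h; lra.
Qed.

Lemma powR_tangent p x y : 1 < p -> 0 <= x -> 0 <= y ->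
  x `^ p + p * x `^ (p - 1) * (y - x) <= y `^ p.
Proof.
move=> p1 x0 y0; have p0 : 0 < p by apply: lt_trans p1.
have [->|xn0] := eqVneq x 0.
  by rewrite !powR0 ?gt_eqF ?subr_gt0 // mulr0 mul0r addr0 powR_ge0.
have xp : 0 < x by rewrite lt0r xn0.
have := powR_bernoulli p1 (divr_ge0 y0 x0).
rewrite -(ler_pM2l (powR_gt0 p xp)) -powRM ?divr_ge0 // [x * (y / x)]mulrC divfK //.
apply: le_trans; rewrite -(mulr_powRB1 x0 p0).
by rewrite le_eqVlt; apply/orP; left; apply/eqP; field.
Qed.

(** In the sum of the two tangent inequalities at the midpoint the linear terms cancel. *)
Lemma powR_midpoint p x y : 1 < p -> 0 <= x -> 0 <= y ->
  (x + y) `^ p <= 2 `^ (p - 1) * (x `^ p + y `^ p).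
Proof.
move=> p1 x0 y0; have p0 : 0 < p by apply: lt_trans p1.
have A0 : 0 <= (x + y) / 2 by rewrite divr_ge0 ?addr_ge0.
have hx := powR_tangent p1 A0 x0; have hy := powR_tangent p1 A0 y0.
have h : 2 * ((x + y) / 2) `^ p <= x `^ p + y `^ p by lra.
have -> : x + y = 2 * ((x + y) / 2) by field.
rewrite powRM // -(mulr_powRB1 (ler0n R 2) p0) -mulrA mulrCA.
by rewrite ler_wpM2l ?powR_ge0.
Qed.

Lemma powRN2_le p : 2 <= p -> 2 `^ (- p) <= p^-1.
Proof.
move=> p2; rewrite powRN lef_pV2 ?posrE ?powR_gt0 //; last by lra.
have p1 : 1 < p by lra.
have := powR_bernoulli p1 (ler0n _ 2); lra.
Qed.

Lemma powR_sqrt x p : 0 <= x -> Num.sqrt x `^ p = Num.sqrt (x `^ p).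
Proof. by move=> x0; rewrite -(powR12_sqrt x0) powRAC powR12_sqrt ?powR_ge0. Qed.

(** Since 1 - u is at most exp(- u), this reduces to the square of u q / 2 <= exp(u q / 2), which
    gives the constant 4. *)
Lemma powR_decay q u : 0 < q -> 0 <= u <= 1 -> (1 - u) `^ q * u ^+ 2 <= 4 / q ^+ 2.
Proof.
move=> q0 /andP[u0 u1].
have h1 : (1 - u) `^ q <= expR (- (u * q)).
  rewrite -mulNr expRM; apply: ge0_ler_powR; rewrite ?nnegrE ?subr_ge0 ?expR_ge0 ?(ltW q0) //.
  exact: expR_ge1Dx.
have e0 : 0 < expR (u * q / 2) by exact: expR_gt0.
have h2 : u * q / 2 <= expR (u * q / 2).
  by apply: le_trans (expR_ge1Dx _); rewrite lerDr.
have h3 : (u * q / 2) ^+ 2 <= expR (u * q).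
  have -> : expR (u * q) = expR (u * q / 2) ^+ 2.
    by rewrite -expRM_natr; congr expR; field.
  by rewrite lerXn2r ?nnegrE ?(ltW e0) // divr_ge0 // mulr_ge0 // ltW.
apply: (@le_trans _ _ (expR (- (u * q)) * u ^+ 2)); first by rewrite ler_wpM2r ?sqr_ge0.
rewrite expRN ler_pdivlMr ?exprn_gt0 // -mulrA ler_pdivrMl ?expR_gt0 //.
lra.
Qed.

(** Near the diagonal the two means differ only to second order; away from it the arithmetic mean
    stays below 1 and its power decays. [powR_decay] balances the two regimes. *)
Lemma powR_mean_le_geometric p x y : 2 <= p -> 0 <= x <= 1 -> 0 <= y <= 1 ->
  ((x + y) / 2) `^ p <= Num.sqrt (x `^ p) * Num.sqrt (y `^ p) + 32 / p.
Proof.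
move=> p2; wlog yx : x y / y <= x.
  move=> h hx hy; have [|/ltW] := leP y x => xy; first exact: h.
  by rewrite addrC [_ * Num.sqrt _]mulrC; exact: h.
move=> /andP[x0 x1] /andP[y0 y1].
rewrite -!powR_sqrt // -powRM ?sqrtr_ge0 //.
set a := Num.sqrt x; set b := Num.sqrt y.
have a0 : 0 <= a by exact: sqrtr_ge0.
have b0 : 0 <= b by exact: sqrtr_ge0.
have ba : b <= a by rewrite ler_sqrt.
have a1 : a <= 1 by rewrite -sqrtr1 ler_sqrt.
have -> : x = a ^+ 2 by rewrite sqr_sqrtr.
have -> : y = b ^+ 2 by rewrite sqr_sqrtr.
set A := (a ^+ 2 + b ^+ 2) / 2.
have A0 : 0 <= A by rewrite divr_ge0 ?addr_ge0 ?sqr_ge0.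
have p1 : 1 < p by lra.
have := powR_tangent p1 A0 (mulr_ge0 a0 b0).
(* With [u = (a - b) / 2], the tangent inequality bounds the excess over the
   geometric mean by [2 p A^(p-1) u^2], and [A <= 1 - u]. *)
have AB : A - a * b = 2 * ((a - b) / 2) ^+ 2 by rewrite /A; field.
have u01 : 0 <= (a - b) / 2 <= 1 by apply/andP; split; lra.
have Au : A <= 1 - (a - b) / 2 by rewrite /A; nra.
have q0 : 0 < p - 1 by lra.
have := powR_decay q0 u01; set u := (a - b) / 2 in AB u01 Au *.
have : A `^ (p - 1) <= (1 - u) `^ (p - 1).
  by apply: ge0_ler_powR; rewrite ?nnegrE ?(ltW q0) ?subr_ge0 //; case/andP: u01.
move=> hA hu ht.
have h2 : p * A `^ (p - 1) * (2 * u ^+ 2) <= p * (8 / (p - 1) ^+ 2).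
  have u20 : 0 <= u ^+ 2 by exact: sqr_ge0.
  have : A `^ (p - 1) * u ^+ 2 <= 4 / (p - 1) ^+ 2.
    by apply: le_trans hu; rewrite ler_wpM2r.
  move=> h; rewrite -mulrA ler_wpM2l //; lra.
(* For p >= 2 one has p <= 2 (p - 1). *)
have h3 : p * (8 / (p - 1) ^+ 2) <= 32 / p.
  rewrite mulrA ler_pdivrMr ?exprn_gt0 // mulrAC ler_pdivlMr; last lra.
  nra.
have e : a * b - A = - (2 * u ^+ 2) by lra.
rewrite e mulrN in ht; lra.
Qed.

End PowerInequalities.

(** * Min-max values *)

Section MinMax.
Variables (R : realType) (n : nat) (e : rel 'I_n) (p : R).
Hypothesis p1 : 1 <= p.
Implicit Types (f : 'rV[R]_n) (B : set 'rV[R]_n).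

Lemma edge_sum_ge0 f : 0 <= edge_sum e p f.
Proof. by do 2?[apply: sumr_ge0 => ? _]; exact: powR_ge0. Qed.

Lemma rayleigh_sphere f : sphere_p p f -> rayleigh e p f = edge_sum e p f.
Proof. by rewrite /rayleigh => ->; rewrite divr1. Qed.

Lemma sphere_powR_le f i : sphere_p p f -> `|f ord0 i| `^ p <= 1.
Proof.
move=> <-; rewrite /pnorm_p (bigD1 i) //= lerDl.
by apply: sumr_ge0 => *; exact: powR_ge0.
Qed.

Lemma sphere_coord_le1 f i : sphere_p p f -> `|f ord0 i| <= 1.
Proof.
have p0 : 0 < p by exact: lt_le_trans p1.
move=> /(sphere_powR_le i); rewrite leNgt => h; rewrite leNgt; apply: contra h => h.
have : 1 `^ p < `|f ord0 i| `^ p by apply: gt0_ltr_powR; rewrite ?nnegrE.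
by rewrite powR1.
Qed.

Lemma edge_sum_le (c : 'I_n -> 'I_n -> R) f : (forall i j, 0 <= c i j) ->
  (forall i j : 'I_n, (i < j)%N -> e i j -> `|f ord0 i - f ord0 j| `^ p <= c i j) ->
  edge_sum e p f <= \sum_i \sum_j c i j.
Proof.
move=> c0 fc; apply: ler_sum => i _.
rewrite big_mkcond; apply: ler_sum => j _.
by case: ifP => // /andP[ij eij]; exact: fc.
Qed.

(** A crude bound that makes [sup] a genuine supremum on subsets of the sphere. *)
Lemma edge_sum_sphere_le f : sphere_p p f -> edge_sum e p f <= \sum_(i < n) \sum_(j < n) 2 `^ p.
Proof.
move=> Sf; apply: edge_sum_le => [i j|i j _ _]; first exact: powR_ge0.
apply: ge0_ler_powR; rewrite ?nnegrE // ?(le_trans ler01) //.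
apply: (le_trans (ler_normB _ _)); rewrite -[2]/(1 + 1).
by apply: lerD; exact: sphere_coord_le1.
Qed.

Lemma genus_ge_nonempty k B : (0 < k)%N -> genus_ge B k -> B !=set0.
Proof.
move=> k0 gB; apply/set0P/eqP => B0; apply: (gB 0 k0); exists (fun=> 0); rewrite B0.
split; first by apply: continuous_subspaceT; exact: cst_continuous.
by split=> x [].
Qed.

Lemma le_sup_rayleigh k B f : F_family p k B -> B f ->
  edge_sum e p f <= sup [set rayleigh e p f | f in B].
Proof.
move=> [BS _] Bf; apply: ub_le_sup; last by exists f => //; exact/rayleigh_sphere/BS.
exists (\sum_(i < n) \sum_(j < n) 2 `^ p) => _ [g /BS Sg <-].
by rewrite rayleigh_sphere // edge_sum_sphere_le.
Qed.

Lemma lambda_p_le k B (M : R) : (0 < k)%N -> F_family p k B ->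
  (forall f, B f -> edge_sum e p f <= M) -> lambda_p e p k <= M.
Proof.
move=> k0 FB hM; apply: (@le_trans _ _ (sup [set rayleigh e p f | f in B])).
  apply: ge_inf; last by exists B.
  (* [inf] is a lower bound only for a set bounded below; members of the family are nonempty, so
     each [sup] is at least 0. *)
  exists 0 => _ [C FC <-]; have [_ [_ [_ /(genus_ge_nonempty k0)[f Cf]]]] := FC.
  exact: le_trans (edge_sum_ge0 f) (le_sup_rayleigh FC Cf).
have [BS [_ [_ /(genus_ge_nonempty k0)[f Bf]]]] := FB.
apply: ge_sup; first by exists (rayleigh e p f), f.
by move=> _ [g Bg <-]; rewrite rayleigh_sphere; [exact: hM|exact: BS].
Qed.

(** The family must be inhabited, as [inf] of the empty set is a default value. *)
Lemma le_lambda_p k (M : R) : F_family (n := n) p k !=set0 ->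
  (forall B, F_family p k B -> exists2 f, B f & M <= edge_sum e p f) ->
  M <= lambda_p e p k.
Proof.
move=> [B FB] hM; apply: lb_le_inf.
  by exists (sup [set rayleigh e p f | f in B]), B.
move=> _ [C FC <-]; have [f Cf Mf] := hM _ FC.
exact: le_trans Mf (le_sup_rayleigh FC Cf).
Qed.

Lemma sphere_F_family : F_family p n (sphere_p (n := n) p).
Proof.
split => //; split; first exact: sphere_closed.
by split=> [x|]; [rewrite /sphere_p /= pnormN|exact: genus_ge_sphere].
Qed.

Definition coord_plane (i j : 'I_n) : set 'rV[R]_n :=
  [set f | forall k, k != i -> k != j -> f ord0 k = 0].

Definition coord_circle (i j : 'I_n) : set 'rV[R]_n :=
  sphere_p p `&` coord_plane i j.

Lemma coord_circle_pnorm i j f : i != j -> coord_circle i j f ->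
  `|f ord0 i| `^ p + `|f ord0 j| `^ p = 1.
Proof.
move=> ij [<- f0]; rewrite /pnorm_p (bigD1 i) //= (bigD1 j) ?[j == i]eq_sym //=.
rewrite big1 ?addr0 // => k /andP[ki kj].
by rewrite f0 // normr0 powR0 // gt_eqF // (lt_le_trans _ p1).
Qed.

Lemma coord_circle_F_family i j : i != j -> F_family p 2 (coord_circle i j).
Proof.
move=> ij; split; first by move=> f [].
split.
  rewrite /coord_circle (_ : coord_plane i j = \bigcap_(k in [set k | k != i /\ k != j])
    ((fun f : 'rV[R]_n => f ord0 k) @^-1` [set 0])).
    apply: closedI; first exact: sphere_closed.
    apply: closed_bigI => k _; apply: closed_comp; last exact: closed_eq.
    by move=> x _; exact: coord_continuous.
  apply/seteqP; split => f /= f0 k; first by case; exact: f0.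
  by move=> ki kj; exact: (f0 k (conj ki kj)).
split.
  move=> f [Sf f0]; split; first by rewrite /sphere_p /= pnormN.
  by move=> k ki kj; rewrite mxE f0 ?oppr0.
(* The rows of [M] are the unit vectors of i and j, so the p-sphere of the plane is carried oddly
   into the circle. *)
pose M : 'M[R]_(2, n) := \matrix_(a, k) ((k == if a == 0 then i else j)%:R).
have ME (x : 'rV[R]_2) k : (x *m M) ord0 k = x ord0 0 * (k == i)%:R + x ord0 1 * (k == j)%:R.
  rewrite mxE big_ord_recl big_ord1 !mxE.
  by rewrite (_ : lift ord0 ord0 = 1) //; exact: val_inj.
refine (@genus_ge_odd_map _ _ _ _ _ _ (mulmx^~ M) _ _ _ (@genus_ge_sphere _ _ p1 2)).
- exact: mulmxr_continuous.
- by move=> x; rewrite mulNmx.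
- move=> x Sx; split; last first.
    by move=> k ki kj; rewrite ME (negbTE ki) (negbTE kj) !mulr0 addr0.
  rewrite /sphere_p /= -[RHS]Sx /pnorm_p (bigD1 i) //= (bigD1 j) ?[j == i]eq_sym //=.
  rewrite big1 => [|k /andP[ki kj]].
    rewrite !ME !eqxx (negbTE ij) [j == i]eq_sym (negbTE ij).
    by rewrite big_ord_recl big_ord1 !mulr0 !mulr1 !addr0 add0r; congr (_ + `|x _ _| `^ _); apply: val_inj.
  rewrite ME (negbTE ki) (negbTE kj) !mulr0 addr0 normr0 powR0 //.
  by rewrite gt_eqF // (lt_le_trans _ p1).
Qed.

(** Only the pair i, j can have two nonzero values, and [powR_midpoint] bounds its term; any other
    edge contributes at most 1. *)
Lemma edge_sum_circle_le (i j : 'I_n) f : 1 < p -> (i < j)%N -> coord_circle i j f ->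
  edge_sum e p f <= (e i j)%:R * 2 `^ (p - 1) + (n * n)%:R.
Proof.
move=> p1' ij Cf; have [Sf f0] := Cf.
have ij' : i != j by apply: contraTneq ij => ->; rewrite ltnn.
have T0 : 0 <= (e i j)%:R * 2 `^ (p - 1) :> R by rewrite mulr_ge0 ?powR_ge0.
apply: le_trans (edge_sum_le (c := fun a b =>
  (if (a == i) && (b == j) then (e i j)%:R * 2 `^ (p - 1) else 0) + 1) _ _) _.
- by move=> a b; rewrite addr_ge0 //; case: ifP.
- move=> a b ab eab; have [/andP[/eqP ai /eqP bj]|nab] := ifP.
    rewrite -ai -bj eab mul1r ai bj.
    apply: (@le_trans _ _ (2 `^ (p - 1))); last by rewrite lerDl.
    have := powR_midpoint p1' (normr_ge0 (f ord0 i)) (normr_ge0 (f ord0 j)).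
    rewrite (coord_circle_pnorm ij' Cf) mulr1; apply: le_trans.
    apply: ge0_ler_powR; rewrite ?nnegrE ?addr_ge0 //; first exact: le_trans p1.
    exact: ler_normB.
  rewrite add0r; have [fa|[fb]] : f ord0 a = 0 \/ f ord0 b = 0.
  + have [ai|ai] := eqVneq a i; have [bj|bj] := eqVneq b j.
    * by rewrite ai bj !eqxx in nab.
    * right; apply: f0 => //; apply: contraTneq ab => ->.
      by rewrite ai ltnn.
    * left; apply: f0 => //; apply: contraTneq ab => ->.
      by rewrite bj ltnn.
    * have [aj|aj] := eqVneq a j; last by left; exact: f0.
      right; apply: f0 => //; apply: contraTneq ab => ->.
      by rewrite aj -leqNgt ltnW.
  + by rewrite fa sub0r normrN; exact: sphere_powR_le.
  + by rewrite fb subr0; exact: sphere_powR_le.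
under eq_bigr do rewrite big_split /=.
rewrite big_split /=; apply: lerD.
  rewrite (bigD1 i) //= [X in _ + X]big1 ?addr0 => [|a /negbTE ai]; last first.
    by apply: big1 => b _; rewrite ai.
  rewrite (bigD1 j) //= !eqxx [X in _ + X]big1 ?addr0 // => b /negbTE bj.
  by rewrite bj.
by rewrite !sumr_const card_ord -mulrnA.
Qed.

End MinMax.

(** Squeezing also yields convergence, so [lim] is a true limit. *)
Lemma L_cut_eq (R : realType) n (e : rel 'I_n) k (l C : R) :
  (forall p, 2 <= p -> l <= 2 `^ (- p) * lambda_p e p k <= l + C / p) ->
  L_cut R e k = l.
Proof.
move=> h; apply/cvg_lim => //.
apply: (@squeeze_cvgr _ _ _ _ (fun=> l) (fun p => l + C / p)).
- by exists 2; split => // p /ltW; exact: h.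
- exact: cvg_cst.
- rewrite -[X in _ --> X]addr0; apply: cvgD; first exact: cvg_cst.
  rewrite -[X in _ --> X](mulr0 C); apply: (@cvgMl_tmp _ _ (pinfty_nbhs R)).
  apply/gtr0_cvgV0; last exact: cvg_id.
  by near=> p; near: p; exact: nbhs_pinfty_gt.
Unshelve. all: by end_near. Qed.

Lemma sum_ord_symm (V : nmodType) n (F : 'I_n -> 'I_n -> V) :
  (forall i j, F i j = F j i) -> (forall i, F i i = 0) ->
  \sum_i \sum_j F i j = (\sum_(i < n) \sum_(j < n | (i < j)%N) F i j) *+ 2.
Proof.
move=> Fsym F0; rewrite mulr2n.
transitivity (\sum_(i < n) \sum_(j < n) ((if (i < j)%N then F i j else 0) +
                             (if (j < i)%N then F j i else 0))).
  apply: eq_bigr => i _; apply: eq_bigr => j _.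
  case: ltngtP => [_|_|/val_inj ->]; rewrite ?addr0 ?add0r //.
under eq_bigr do rewrite big_split.
rewrite big_split /= [X in _ + X]exchange_big /=.
by congr (_ + _); apply: eq_bigr => i _; rewrite -big_mkcond.
Qed.

(** For b = a + c, moving x units across adds x (c - x) to the product. *)
Lemma leq_mul_halves a b : (a * b <= (a + b)./2 * uphalf (a + b))%N.
Proof.
wlog ab : a b / (a <= b)%N.
  by move=> h; case: (leqP a b) => [|/ltnW] /h; rewrite // mulnC addnC.
rewrite -(subnKC ab); move: (b - a)%N => c.
have -> : ((a + (a + c))./2 = a + c./2)%N by lia.
have -> : (uphalf (a + (a + c)) = a + (c - c./2))%N by rewrite uphalfE; lia.
have : (c./2 <= c)%N by lia.
by move: (c./2) => x xc; nia.
Qed.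

Lemma sqrt_mul_le_mean (R : realType) (a b : R) : 0 <= a -> 0 <= b ->
  2 * (Num.sqrt a * Num.sqrt b) <= a + b.
Proof.
move=> a0 b0; have := sqr_ge0 (Num.sqrt a - Num.sqrt b).
rewrite sqrrB !sqr_sqrtr //; lra.
Qed.

(** * Edge sums on the complete graph *)

Section CompleteGraph.
Variables (R : realType) (n : nat) (e : rel 'I_n) (p : R).
Hypothesis ce : complete_graph e.
Hypothesis p2 : 2 <= p.
Implicit Types f : 'rV[R]_n.

Let p1 : 1 <= p. Proof. by apply: le_trans p2; rewrite ler1n. Qed.
Let p0 : 0 < p. Proof. exact: lt_le_trans p1. Qed.

Lemma edge_sum_complete f :
  edge_sum e p f *+ 2 = \sum_i \sum_j `|f ord0 i - f ord0 j| `^ p.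
Proof.
rewrite sum_ord_symm => [|i j|i]; [|by rewrite distrC|].
  congr (_ *+ 2); apply: eq_bigr => i _; apply: eq_bigl => j.
  case: (ltnP i j) => // ij; apply: ce; apply: contraTneq ij => ->.
  by rewrite ltnn.
by rewrite subrr normr0 powR0 // gt_eqF.
Qed.

(** The maximum of the positive part of [f]; [max0 (- f)] is that of the negative part. *)
Definition max0 f : R := \big[Num.max/0]_i f ord0 i.

Lemma max0_ge0 f : 0 <= max0 f.
Proof. exact: bigmax_ge_id. Qed.

Lemma le_max0 f i : f ord0 i <= max0 f.
Proof. exact: (le_bigmax _ _ i). Qed.

Lemma max0_continuous : continuous max0.
Proof. by apply: bigmax_continuous => i; exact: coord_continuous. Qed.

Lemma max0_attained f : 0 < max0 f -> exists i, f ord0 i = max0 f.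
Proof.
suff [->|[i <-]] : max0 f = 0 \/ exists i, f ord0 i = max0 f.
- by rewrite ltxx.
- by exists i.
rewrite /max0; elim/big_ind: _ => [|x y hx hy|i _]; [by left| |by right; exists i].
by rewrite /Num.max; case: ifP.
Qed.

Lemma balanced_edge_sum f : sphere_p p f -> max0 f = max0 (- f) ->
  2 `^ p <= edge_sum e p f *+ 2.
Proof.
move=> Sf bal.
have f0 : f != 0.
  rewrite -(pnorm_eq0 p1); have -> : pnorm_p p f = 1 := Sf.
  exact: oner_neq0.
have M0 : 0 < max0 f.
  rewrite lt0r max0_ge0 andbT; apply: contra f0 => /eqP M0; apply/eqP/rowP => i.
  have := le_max0 f i; have := le_max0 (- f) i; rewrite -bal M0 !mxE => h1 h2.
  by apply/eqP; rewrite eq_le h2 -oppr_le0.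
have [u fu] := max0_attained M0.
have [v] : exists v, (- f) ord0 v = max0 (- f) by apply: max0_attained; rewrite -bal.
rewrite -bal mxE => fv.
have uv : u != v by apply: contraTneq M0 => uv; move: fu fv; rewrite uv => fu fv; rewrite -leNgt; lra.
(* The two rows of a maximum and of a minimum suffice: [f u] and [f v] are [M] and
   [- M], and one of [|M - f j|], [|M + f j|] is at least [2 |f j|]. *)
rewrite edge_sum_complete (bigD1 u) //= [X in _ <= _ + X](bigD1 v) ?[v == u]eq_sym //= addrA.
apply: (@le_trans _ _ (\sum_j `|f ord0 u - f ord0 j| `^ p + \sum_j `|f ord0 v - f ord0 j| `^ p)).
  have -> : 2 `^ p = \sum_j 2 `^ p * `|f ord0 j| `^ p :> R.
    by rewrite -mulr_sumr -[LHS]mulr1; congr (_ * _); exact/esym.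
  rewrite -big_split; apply: ler_sum => j _ /=; rewrite -powRM //.
  have h1 := le_max0 f j; have := le_max0 (- f) j; rewrite -bal mxE => h2.
  have [fj|fj] := leP 0 (f ord0 j).
    apply: ler_wpDl; first exact: powR_ge0.
    apply: ge0_ler_powR; rewrite ?nnegrE ?mulr_ge0 ?(ltW p0) //.
    rewrite ger0_norm // ler0_norm; lra.
  apply: ler_wpDr; first exact: powR_ge0.
  apply: ge0_ler_powR; rewrite ?nnegrE ?mulr_ge0 ?(ltW p0) //.
  rewrite ltr0_norm // ger0_norm; lra.
by rewrite lerDl; do 2?[apply: sumr_ge0 => ? _]; exact: powR_ge0.
Qed.

Lemma le_lambda_p2 : (2 <= n)%N -> 2 `^ p / 2 <= lambda_p e p 2.
Proof.
move=> n2; apply: le_lambda_p => //.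
  exists (coord_circle p (Ordinal (ltnW n2)) (Ordinal n2)).
  exact: coord_circle_F_family.
move=> B [BS [_ [BN gB]]]; apply: contrapT => noB.
(* This map is odd, hence vanishes somewhere on a set of genus at least 2. *)
apply: (gB 1 isT); exists (fun f => (max0 f - max0 (- f)) *: const_mx 1); split.
  apply: continuous_subspaceT => f; apply: (@cvgZr_tmp _ _ _ (nbhs f)).
  apply: (@cvgB _ _ _ (nbhs f)); first exact: max0_continuous.
  apply: (@continuous_comp _ _ _ (fun f : 'rV[R]_n => - f) max0); first exact: opp_continuous.
  exact: max0_continuous.
split=> f Bf; first by rewrite opprK -scaleNr opprB.
rewrite scaler_eq0 negb_or; apply/andP; split; last first.
  by apply/eqP => /rowP/(_ ord0)/eqP; rewrite !mxE oner_eq0.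
apply/negP; rewrite subr_eq0 => /eqP bal; apply: noB; exists f => //.
by rewrite ler_pdivrMr // mulr_natr; apply: balanced_edge_sum => //; exact: BS.
Qed.

(* For a cut [P] of sizes [a], [b], AM-GM applied to
   [(sqrt a * s i) * (sqrt b * s j)] gives the bound [sqrt (a b) / 2]. *)
Lemma cut_sum_le (P : pred 'I_n) (s : 'I_n -> R) : (forall i, 0 <= s i) ->
  \sum_i s i ^+ 2 = 1 ->
  \sum_(i | P i) \sum_(j | ~~ P j) s i * s j <= Num.sqrt (n./2 * uphalf n)%:R / 2.
Proof.
move=> s0 s1; set T := \sum_(i | _) _.
set a := #|P|; set b := #|[pred j | ~~ P j]|.
have ab : (a + b)%N = n by rewrite /a /b cardC card_ord.
have Kle : (a * b <= n./2 * uphalf n)%N.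
  by rewrite -ab leq_mul_halves.
(* If one side of the cut is empty the sum is 0; the division by [w] below requires both to be
   nonempty. *)
have [K0|K0] := posnP (a * b).
  rewrite /T; have [a0|b0] : a = 0%N \/ b = 0%N by lia.
    by rewrite big_pred0 ?divr_ge0 ?sqrtr_ge0 // => i; exact: (card0_eq a0).
  rewrite big1 ?divr_ge0 ?sqrtr_ge0 // => i _; rewrite big_pred0 // => j.
  exact: (card0_eq b0).
apply: (@le_trans _ _ (Num.sqrt (a * b)%:R / 2)); last first.
  by rewrite ler_pM2r // ler_wsqrtr // ler_nat.
set w := Num.sqrt (a * b)%:R; have w0 : 0 < w by rewrite sqrtr_gt0 ltr0n.
suff : 2 * w * T <= w ^+ 2.
  by rewrite expr2 mulrAC ler_pM2r // => h; rewrite ler_pdivlMr // mulrC.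
have wE : w = Num.sqrt a%:R * Num.sqrt b%:R by rewrite /w natrM sqrtrM.
have -> : w ^+ 2 = \sum_(i | P i) \sum_(j | ~~ P j) (a%:R * s i ^+ 2 + b%:R * s j ^+ 2).
  rewrite sqr_sqrtr // -[LHS]mulr1 -s1 (bigID P) /= mulrDr.
  under [RHS]eq_bigr do rewrite big_split /=.
  rewrite big_split /=; congr (_ + _).
    rewrite mulr_sumr; apply: eq_bigr => i _.
    by rewrite sumr_const -/b -mulr_natr natrM; ring.
  by rewrite sumr_const -/a -mulr_sumr -mulr_natr natrM; ring.
rewrite /T mulr_sumr; apply: ler_sum => i _; rewrite mulr_sumr; apply: ler_sum => j _.
have := sqr_ge0 (Num.sqrt a%:R * s i - Num.sqrt b%:R * s j).
rewrite sqrrB !exprMn !sqr_sqrtr // wE => h.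
rewrite -subr_ge0; apply: le_trans h _; rewrite le_eqVlt; apply/orP; left; apply/eqP.
by rewrite -mulr_natl; ring.
Qed.

(** The square roots of the p-masses form a Euclidean unit vector. Pairs of opposite sign are
    compared with its products and fall under [cut_sum_le] for the sign cut; the other pairs go into
    the error term. *)
Lemma edge_sum_complete_le f : sphere_p p f ->
  2 `^ (- p) * edge_sum e p f <= Num.sqrt (n./2 * uphalf n)%:R / 2 + (16 * (n * n)%:R) / p.
Proof.
move=> Sf; rewrite powRN ler_pdivrMl ?powR_gt0 //.
pose s i := Num.sqrt (`|f ord0 i| `^ p); pose P i := 0 <= f ord0 i.
have hs : \sum_i s i ^+ 2 = 1.
  by rewrite -[RHS]Sf; apply: eq_bigr => i _; rewrite sqr_sqrtr // powR_ge0.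
have pair i j : `|f ord0 i - f ord0 j| `^ p <=
    2 `^ p * ((if P i != P j then s i * s j else 0) + 32 / p).
  have ci := sphere_coord_le1 p1 i Sf; have cj := sphere_coord_le1 p1 j Sf.
  case: ifPn => [_|]; rewrite /P.
    apply: (@le_trans _ _ (2 `^ p * ((`|f ord0 i| + `|f ord0 j|) / 2) `^ p)).
      rewrite -powRM ?divr_ge0 ?addr_ge0 // [2 * _]mulrC divfK //.
      by apply: ge0_ler_powR; rewrite ?nnegrE ?addr_ge0 ?(ltW p0) //; exact: ler_normB.
    rewrite ler_wpM2l ?powR_ge0 //.
    by apply: powR_mean_le_geometric => //; rewrite normr_ge0.
  move=> /negPn/eqP same; rewrite add0r.
  apply: (@le_trans _ _ 1).
    have <- : 1 `^ p = 1 :> R by rewrite powR1.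
    apply: ge0_ler_powR; rewrite ?nnegrE ?(ltW p0) //.
    move: ci cj; rewrite !ler_norml => /andP[? ?] /andP[? ?].
    by move: same; case: leP => ?; case: leP => // ? _; apply/andP; split; lra.
  rewrite -ler_pdivrMl ?powR_gt0 // mulr1 -powRN.
  apply: (le_trans (powRN2_le p2)); rewrite ler_peMl ?invr_ge0 ?(ltW p0) //.
  by rewrite ler1n.
(* Doubling passes to ordered pairs, so an error of 32 / p per pair gives the constant 16. *)
rewrite -(ler_pMn2r (n := 2)) // edge_sum_complete.
apply: (@le_trans _ _ (\sum_i \sum_j
    2 `^ p * ((if P i != P j then s i * s j else 0) + 32 / p))).
  by do 2![apply: ler_sum => ? _]; exact: pair.
under eq_bigr do rewrite -mulr_sumr big_split /= sumr_const card_ord.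
rewrite -mulr_sumr big_split /= sumr_const card_ord -[leRHS]mulrnAr.
rewrite ler_wpM2l ?powR_ge0 // mulrnDl; apply: lerD; last first.
  rewrite -mulrnA -[_ *+ (n * n)]mulr_natr -[_ *+ 2]mulr_natr.
  by rewrite le_eqVlt; apply/orP; left; apply/eqP; ring.
have -> : \sum_i \sum_j (if P i != P j then s i * s j else 0) =
    (\sum_(i | P i) \sum_(j | ~~ P j) s i * s j) *+ 2.
  rewrite mulr2n (bigID P) /=; congr (_ + _).
    apply: eq_bigr => i Pi; rewrite [RHS]big_mkcond; apply: eq_bigr => j _.
    by rewrite Pi; case: (P j).
  rewrite [RHS]exchange_big; apply: eq_bigr => i /negbTE Pi.
  rewrite [RHS]big_mkcond; apply: eq_bigr => j _.
  by rewrite Pi mulrC; case: (P j).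
rewrite ler_pMn2r //; apply: cut_sum_le => // i; exact: sqrtr_ge0.
Qed.

Lemma card_ord_lt k : (k <= n)%N -> #|[pred i : 'I_n | (i < k)%N]| = k.
Proof.
move=> kn; rewrite -sum1_card -[RHS]card_ord -sum1_card.
by rewrite (big_ord_widen _ (fun=> 1%N) kn).
Qed.

(** The witness is constant on each side of the most balanced cut, with opposite signs and half of
    the p-mass on each side: the equality case of AM-GM in [cut_sum_le]. *)
Lemma exists_edge_sum_ge : (2 <= n)%N -> exists2 f, sphere_p p f &
  2 `^ p * (Num.sqrt (n./2 * uphalf n)%:R / 2) <= edge_sum e p f.
Proof.
move=> n2; set k := n./2; set l := uphalf n.
have k0 : (0 < k)%N by rewrite half_gt0.
have l0 : (0 < l)%N by rewrite uphalf_gt0 (leq_trans _ n2).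
have kl : (k + l)%N = n by rewrite addnC /k /l uphalf_half -addnA addnn odd_double_half.
have k0' : 0 < k%:R :> R by rewrite ltr0n.
have l0' : 0 < l%:R :> R by rewrite ltr0n.
pose al : R := (2 * k%:R)^-1; pose be : R := (2 * l%:R)^-1.
have al0 : 0 < al by rewrite invr_gt0 mulr_gt0.
have be0 : 0 < be by rewrite invr_gt0 mulr_gt0.
pose a := al `^ p^-1; pose b := be `^ p^-1.
have a0 : 0 <= a by exact: powR_ge0.
have b0 : 0 <= b by exact: powR_ge0.
have ap : a `^ p = al by rewrite -powRrM mulVf ?gt_eqF // powRr1 // ltW.
have bp : b `^ p = be by rewrite -powRrM mulVf ?gt_eqF // powRr1 // ltW.
pose f : 'rV[R]_n := \row_i if (i < k)%N then a else - b.
have ck : #|[pred i : 'I_n | (i < k)%N]| = k by apply: card_ord_lt; rewrite -kl leq_addr.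
have cl : #|[pred i : 'I_n | ~~ (i < k)%N]| = l.
  by apply/eqP; rewrite -(eqn_add2l k) -{1}ck cardC card_ord kl.
exists f.
  rewrite /sphere_p /= /pnorm_p (bigID (fun i : 'I_n => (i < k)%N)) /=.
  under eq_bigr => i ik do rewrite mxE ik ger0_norm // ap.
  rewrite sumr_const ck.
  under eq_bigr => i ik do rewrite mxE (negbTE ik) normrN ger0_norm // bp.
  rewrite sumr_const cl -[_ *+ k]mulr_natr -[_ *+ l]mulr_natr /al /be; field.
  by rewrite !gt_eqF.
(* Only the cut edges are kept; as one side consists of the first [k] indices, they satisfy i <
   j. *)
apply: (@le_trans _ _ (\sum_(i < n | (i < k)%N) \sum_(j < n | ~~ (j < k)%N) (a + b) `^ p)); last first.
  rewrite /edge_sum big_mkcond; apply: ler_sum => i _.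
  case: ifP => ik; last by apply: sumr_ge0 => j _; exact: powR_ge0.
  rewrite big_mkcond [leRHS]big_mkcond; apply: ler_sum => j _.
  case: ifPn => jk; last by case: ifP => // _; exact: powR_ge0.
  have ij : (i < j)%N by rewrite (leq_trans ik) // leqNgt.
  rewrite ij ce /=; last by apply: contraTneq ij => ->; rewrite ltnn.
  by rewrite !mxE ik (negbTE jk) opprK ger0_norm // addr_ge0.
rewrite !sumr_const ck cl -mulrnA -[_ *+ (l * k)]mulr_natr [(l * k)%N]mulnC.
(* By AM-GM for [a] and [b]; then k l sqrt (al be) = sqrt (k l) / 2. *)
have abp : 2 `^ p * (Num.sqrt al * Num.sqrt be) <= (a + b) `^ p.
  have -> : Num.sqrt al = Num.sqrt a `^ p by rewrite powR_sqrt // ap.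
  have -> : Num.sqrt be = Num.sqrt b `^ p by rewrite powR_sqrt // bp.
  rewrite -powRM ?sqrtr_ge0 // -powRM ?mulr_ge0 ?sqrtr_ge0 //.
  apply: ge0_ler_powR; rewrite ?nnegrE ?mulr_ge0 ?addr_ge0 ?sqrtr_ge0 ?(ltW p0) //.
  exact: sqrt_mul_le_mean.
apply: le_trans (_ : 2 `^ p * (Num.sqrt al * Num.sqrt be) * (k * l)%:R <= _); last first.
  by rewrite ler_wpM2r.
rewrite -mulrA ler_wpM2l ?powR_ge0 //.
set w := Num.sqrt (k * l)%:R.
have w0 : 0 < w by rewrite sqrtr_gt0 ltr0n muln_gt0 k0.
have w2 : (k * l)%:R = w ^+ 2 :> R by rewrite sqr_sqrtr.
rewrite -sqrtrM ?(ltW al0) // (_ : al * be = (2 * w)^-1 ^+ 2); last first.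
  by rewrite exprVn exprMn -w2 natrM /al /be; field; rewrite !gt_eqF.
rewrite sqrtr_sqr ger0_norm ?invr_ge0 ?mulr_ge0 ?(ltW w0) // w2.
by rewrite le_eqVlt; apply/orP; left; apply/eqP; field; rewrite gt_eqF.
Qed.

End CompleteGraph.

(** * The values of L_2 and L_n *)

Lemma L_cut_2_complete (R : realType) n (e : rel 'I_n) : (2 <= n)%N ->
  complete_graph e -> L_cut R e 2 = 1 / 2.
Proof.
move=> n2 ce; apply: (@L_cut_eq _ _ _ _ _ (n * n)%:R) => p p2.
have p1 : 1 < p by lra.
rewrite powRN ler_pdivlMl ?powR_gt0 // ler_pdivrMl ?powR_gt0 //; apply/andP; split.
  by rewrite mul1r; exact: le_lambda_p2.
pose i := Ordinal (ltnW n2); pose j := Ordinal n2.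
apply: (lambda_p_le (ltW p1) (k := 2) isT (coord_circle_F_family (ltW p1) (i := i) (j := j) isT)).
move=> f /(edge_sum_circle_le e (ltW p1) p1 (i := i) (j := j) isT)/le_trans; apply.
(* The main term is half of 2^p, and [powRN2_le] absorbs n * n into the error. *)
rewrite mulrDr; apply: lerD.
  have := mulr_powRB1 (ler0n R 2) (lt_trans ltr01 p1).
  rewrite ce //=; lra.
rewrite mulrCA -[X in X <= _]mulr1 ler_wpM2l //.
rewrite -ler_pdivrMl ?powR_gt0 // mulr1 -powRN; exact: powRN2_le.
Qed.

(** On the circle of a non-adjacent pair the edge sum is at most n * n for every p, and division by
    2^p removes it in the limit. *)
Lemma L_cut_2_incomplete (R : realType) n (e : rel 'I_n) (i j : 'I_n) :
  (i < j)%N -> ~~ e i j -> L_cut R e 2 = 0.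
Proof.
move=> ij neij; apply: (@L_cut_eq _ _ _ _ _ (n * n)%:R) => p p2.
have p1 : 1 < p by lra.
have ij' : i != j by apply: contraTneq ij => ->; rewrite ltnn.
have Fc := coord_circle_F_family (ltW p1) ij'.
have lam0 : 0 <= lambda_p e p 2.
  apply: le_lambda_p; [exact: ltW|by exists (coord_circle p i j)|].
  move=> B [_ [_ [_ /(@genus_ge_nonempty _ _ 2 _ isT)[f Bf]]]]; exists f => //.
  exact: edge_sum_ge0.
rewrite mulr_ge0 ?powR_ge0 //= add0r mulrC.
apply: ler_pM; rewrite ?powR_ge0 ?powRN2_le //.
apply: (lambda_p_le (ltW p1) _ Fc) => // f /(edge_sum_circle_le e (ltW p1) p1 ij).
by rewrite (negbTE neij) mul0r add0r.
Qed.

(** By [genus_ge_full] each competing set contains the extremal function, and the sphere itself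
    gives the upper bound. *)
Lemma L_cut_n_complete (R : realType) n (e : rel 'I_n) : (2 <= n)%N ->
  complete_graph e -> L_cut R e n = Num.sqrt (n./2 * uphalf n)%:R / 2.
Proof.
move=> n2 ce; apply: (@L_cut_eq _ _ _ _ _ (16 * (n * n)%:R)) => p p2.
have p1 : 1 <= p by lra.
apply/andP; split.
  rewrite powRN ler_pdivlMl ?powR_gt0 //; apply: (le_lambda_p p1).
    by exists (sphere_p p); exact: sphere_F_family.
  move=> B [BS [_ [BN gB]]]; have [f Sf hf] := exists_edge_sum_ge ce p2 n2.
  by exists f => //; exact: genus_ge_full p1 BS BN gB _ Sf.
rewrite powRN ler_pdivrMl ?powR_gt0 //.
apply: (lambda_p_le p1 _ (sphere_F_family _ p1)); first exact: ltnW.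
move=> f /(edge_sum_complete_le ce p2).
by rewrite powRN ler_pdivrMl ?powR_gt0.
Qed.

Theorem theorem8p5 (R : realType) (n : nat) (e : rel 'I_n)
    (e_sym : symmetric e) (e_irr : irreflexive e) (hn : (2 <= n)%N) :
  ((0 < L_cut R e 2) <-> complete_graph e) /\
  (complete_graph e ->
     L_cut R e 2 = 1 / 2 /\
     L_cut R e n = (if odd n then Num.sqrt (n%:R ^+ 2 - 1) / 4 else n%:R / 4)).
Proof.
split.
  split=> [L0 i j ij|ce]; last by rewrite L_cut_2_complete // divr_gt0.
  apply: contraTT L0 => neij; rewrite -leNgt.
  move: ij neij; wlog ij : i j / (i < j)%N.
    move=> h ij neij; have [lt|gt|/val_inj eq] := ltngtP i j; first exact: (h i j).
      by apply: (h j i); rewrite // 1?eq_sym // e_sym.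
    by rewrite eq eqxx in ij.
  by move=> _ neij; rewrite (L_cut_2_incomplete R ij neij).
move=> ce; split; first exact: L_cut_2_complete.
rewrite L_cut_n_complete // uphalf_half.
(* With n = 2 h + 1 one has n^2 - 1 = 4 h (h + 1); for n = 2 h the root is that of h^2. *)
have := odd_double_half n; move: (n./2) (odd n) => h b <-; case: b => /=.
  rewrite (_ : _ ^+ 2 - 1 = 2 ^+ 2 * (h * (1 + h))%:R); last first.
    by rewrite -muln2 !(natrM, natrD); ring.
  by rewrite sqrtrM ?sqr_ge0 // sqrtr_sqr ger0_norm //; field.
by rewrite !add0n natrM -expr2 sqrtr_sqr ger0_norm // -muln2 natrM; field.
Qed.
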